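(* For each pair $\{p,q\}$ of distinct parameters from the set $\{\text{area},\text{perimeter},\text{height},\text{width}\}$, there exist rectangle visibility graphs $G_1$ and $G_2$ with the same number of vertices such that $p(G_1)<p(G_2)$ but $q(G_2)<q(G_1)$.
   Context: An integer rectangle is a set $[x_1,x_2]\times[y_1,y_2]$ with $x_1<x_2$, $y_1<y_2$ integers. Let $S$ be a finite set of integer rectangles with pairwise disjoint interiors (rectangles may share boundary edges). Two rectangles $A,B\in S$ see each other if there is a vertical or horizontal line segment that intersects the interiors of both $A$ and $B$ and intersects no other (closed) rectangle of $S$. $S$ is an RV-representation of a graph $G$ if the vertices of $G$ correspond bijectively to the rectangles of $S$ so that two vertices are adjacent if and only if their rectangles see each other. A graph having an RV-representation is a rectangle visibility graph (RVG). The bounding box of $S$ is the smallest axis-parallel rectangle $R$ containing all rectangles of $S$; it is always turned (rotated by $90^\circ$ if necessary) so that its height is at most its width. Thus the height of $R$ is its shorter side length and the width of $R$ is its longer side length. For an RVG $G$, $\operatorname{height}(G)$, $\operatorname{width}(G)$, $\operatorname{area}(G)$, $\operatorname{perim}(G)$ (the perimeter of $G$) are the minimum height, width, area, perimeter, respectively, of the bounding box, each minimum being taken separately over all RV-representations of $G$. *)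

(* Defs.v *)
From HB Require Import structures.
From mathcomp Require Import all_boot all_order all_algebra.
From mathcomp Require Import all_classical all_reals all_analysis.

Set Implicit Arguments.
Unset Strict Implicit.
Unset Printing Implicit Defensive.

Import Order.TTheory GRing.Theory Num.Theory.
Import numFieldNormedType.Exports.

Local Open Scope classical_set_scope.
Local Open Scope ring_scope.

(* Finite simple graphs. *)
Record graph := Graph {
  vertex :> finType;
  edge : rel vertex;
  edge_sym : symmetric edge;
  edge_irr : irreflexive edge }.

Record int_rect := IntRect {
  left : int;
  right : int;
  bottom : int;
  top : int;
  left_lt_right : left < right;
  bottom_lt_top : bottom < top }.

(* Axis-parallel rectangles and segments are subsets of the real plane R * R;
   the corners of a rectangle of S are integers, but a line of sight may lie at
   any real height or abscissa. *)
Definition rectangle (R : realType) (a b c d : R) : set (R * R) :=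
  `[a, b] `*` `[c, d].

Definition region (R : realType) (A : int_rect) : set (R * R) :=
  rectangle (left A)%:~R (right A)%:~R (bottom A)%:~R (top A)%:~R.
Arguments region R A : clear implicits.

Definition axis_segment (R : realType) (s : set (R * R)) : Prop :=
  (exists a b y : R, a <= b /\ s = `[a, b] `*` [set y]) \/
  (exists x a b : R, a <= b /\ s = [set x] `*` `[a, b]).

(* [r] lists the rectangles of S. *)
Definition sees (R : realType) (T : finType) (r : T -> int_rect) (i j : T) :
    Prop :=
  exists s : set (R * R),
    [/\ axis_segment s,
        s `&` (region R (r i))° !=set0,
        s `&` (region R (r j))° !=set0 &
        forall k : T, k != i -> k != j -> s `&` region R (r k) = set0].

(* Disjointness of interiors for distinct indices makes [r] injective, so the
   vertices are in bijection with the set of rectangles. *)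
Definition RV_representation (R : realType) (G : graph) (r : G -> int_rect) :
    Prop :=
  (forall i j : G, i != j ->
     (region R (r i))° `&` (region R (r j))° = set0) /\
  (forall i j : G, i != j -> (edge i j <-> sees R r i j)).

Definition RVG (R : realType) (G : graph) : Prop :=
  exists r : G -> int_rect, RV_representation R r.

(* Minimality is among all rectangles with real corners; the minimal one has
   integer corners, see [bounding_box_ex]. *)
Definition bounding_box (R : realType) (T : finType) (r : T -> int_rect)
    (B : int_rect) : Prop :=
  (forall i : T, region R (r i) `<=` region R B) /\
  (forall a b c d : R,
     (forall i : T, region R (r i) `<=` rectangle a b c d) ->
     region R B `<=` rectangle a b c d).

Variant parameter := Area | Perimeter | Height | Width.

(* Up to a rotation by 90 degrees, the height is the shorter side. *)
Definition box_param (p : parameter) (B : int_rect) : nat :=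
  let a := `|right B - left B|%N in
  let b := `|top B - bottom B|%N in
  match p with
  | Area => (a * b)%N
  | Perimeter => (2 * (a + b))%N
  | Height => minn a b
  | Width => maxn a b
  end.

Definition attained (R : realType) (p : parameter) (G : graph) : set nat :=
  [set m | exists (r : G -> int_rect) (B : int_rect),
     [/\ RV_representation R r, bounding_box R r B & box_param p B = m]].

(* The least attained value; it exists for every RVG with at least one vertex,
   see [graph_paramP].  The default 0 is returned for the graph with no vertex,
   which has no bounding box. *)
Definition graph_param (R : realType) (p : parameter) (G : graph) : nat :=
  xget 0%N [set m | attained R p G m /\
                    forall m', attained R p G m' -> (m <= m')%N].

Lemma in_rectangle (R : realType) (a b c d : R) (z : R * R) :
  rectangle a b c d z <->
  [/\ a <= z.1, z.1 <= b, c <= z.2 & z.2 <= d].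
Proof.
rewrite /rectangle /=; split.
  by move=> [] /=; rewrite !in_itv /= => /andP[? ?] /andP[? ?].
by move=> [h1 h2 h3 h4]; split => /=; rewrite in_itv /= ?h1 ?h2 ?h3 ?h4.
Qed.

Lemma interior_region (R : realType) (A : int_rect) :
  (region R A)° =
  `](left A)%:~R, (right A)%:~R[ `*` `](bottom A)%:~R, (top A)%:~R[.
Proof.
rewrite -!(interior_itv_bnd _ _ true false); apply/seteqP; split => -[x y].
  move=> [[P Q] /= [Px Qy] PQ]; split => /=.
    apply: filterS Px => u Pu; have := PQ (u, y).
    by case=> //=; split=> //; apply: nbhs_singleton Qy.
  apply: filterS Qy => v Qv; have := PQ (x, v).
  by case=> //=; split=> //; apply: nbhs_singleton Px.
by move=> [/= Px Qy]; exists (`[(left A)%:~R, (right A)%:~R]%classic,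
  `[(bottom A)%:~R, (top A)%:~R]%classic).
Qed.

Lemma bounding_box_ex (R : realType) (T : finType) (r : T -> int_rect) :
  (0 < #|T|)%N -> exists B, bounding_box R r B.
Proof.
case/card_gt0P=> i0 _.
have [l _ hl] := @arg_minP _ _ _ i0 predT (fun i => left (r i)) isT.
have [t _ ht] := @arg_maxP _ _ _ i0 predT (fun i => right (r i)) isT.
have [b _ hb] := @arg_minP _ _ _ i0 predT (fun i => bottom (r i)) isT.
have [u _ hu] := @arg_maxP _ _ _ i0 predT (fun i => top (r i)) isT.
have lt1 : left (r l) < right (r t).
  exact: lt_le_trans (left_lt_right (r l)) (ht l isT).
have lt2 : bottom (r b) < top (r u).
  exact: lt_le_trans (bottom_lt_top (r b)) (hu b isT).
exists (IntRect lt1 lt2); split=> [i z|a b' c d sub z].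
  move=> /in_rectangle[h1 h2 h3 h4]; apply/in_rectangle => /=; split.
  - by apply: le_trans h1; rewrite ler_int hl.
  - by apply: le_trans h2 _; rewrite ler_int; apply: ht.
  - by apply: le_trans h3; rewrite ler_int hb.
  - by apply: le_trans h4 _; rewrite ler_int; apply: hu.
have bl i : region R (r i) ((left (r i))%:~R, (bottom (r i))%:~R).
  by apply/in_rectangle; rewrite /= !lexx !ler_int !ltW
    ?left_lt_right ?bottom_lt_top.
have tr i : region R (r i) ((right (r i))%:~R, (top (r i))%:~R).
  by apply/in_rectangle; rewrite /= !lexx !ler_int !ltW
    ?left_lt_right ?bottom_lt_top.
move=> /in_rectangle[/= h1 h2 h3 h4]; apply/in_rectangle.
have /in_rectangle[/= k1 _ _ _] := sub l _ (bl l).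
have /in_rectangle[/= _ k2 _ _] := sub t _ (tr t).
have /in_rectangle[/= _ _ k3 _] := sub b _ (bl b).
have /in_rectangle[/= _ _ _ k4] := sub u _ (tr u).
by split; [exact: le_trans h1|exact: le_trans k2|exact: le_trans h3|
  exact: le_trans k4].
Qed.

Lemma graph_paramP (R : realType) (p : parameter) (G : graph) :
  RVG R G -> (0 < #|G|)%N ->
  attained R p G (graph_param R p G) /\
  forall m, attained R p G m -> (graph_param R p G <= m)%N.
Proof.
move=> [r hr] /(bounding_box_ex R r)[B hB].
have ex : exists m, `[< attained R p G m >].
  by exists (box_param p B); apply/asboolP; exists r, B.
pose P := [set m | attained R p G m /\
                   forall m', attained R p G m' -> (m <= m')%N].
suff : P (graph_param R p G) by [].
apply: xgetPex; case: (ex_minnP ex) => m /asboolP hm hmin.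
by exists m; split=> // m' hm'; apply/hmin/asboolP.
Qed.

(* Main.v *)
Require Import Defs.
From mathcomp Require Import all_boot all_order all_algebra.
From mathcomp Require Import all_classical all_reals all_analysis.
From mathcomp Require Import zify lra.

(** All comparisons are made against one reference graph on 14 vertices, the
    disjoint union [triangles] of four triangles and two isolated vertices; its
    bounding boxes are at least 10 in both directions, and 10 x 10 is attained.
    Each of the other three graphs on 14 vertices is smaller in some parameters
    and larger in another, and every pair of parameters occurs.

    - [double_fan], a path on 12 vertices all joined to two further, nonadjacent
      vertices, fits in a 12 x 3 box but has width at least 12.  So it has
      smaller height, area and perimeter and larger width.
    - [matching], seven disjoint edges, fits in a 14 x 7 box, while the sides of
      any of its boxes add up to at least 21.  So it has smaller height and area
      (at most 98 against 100) but larger perimeter (at least 42 against 40).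
    - [near_matching], six disjoint edges and two isolated vertices, fits in a
      14 x 8 box, while its boxes have sides at least 8 with sum at least 22,
      hence area at least 112.  So it has smaller height and larger area.

    Visibility over the reals becomes combinatorial once the box is cut into unit
    rows and columns: a line of sight can be moved into the interior of one of
    these strips, where it is blocked exactly by the rectangles that fill the
    strip between its ends ([strip_representationP]).

    Two arguments give the lower bounds.  First, two rectangles in a common strip
    are joined by a path in the graph, so different components use different
    rows and columns and their dimensions add up ([class_strips_sum]).  A
    component with n vertices using h rows and w columns has n <= h * w
    ([card_class_le]), so an edge has h + w >= 3; and a triangle does not fit in
    one row or one column ([triangle_class_strips]).  Second, if a rectangle lies
    above another one, their common neighbours can be assigned distinct columns,
    so there are at most as many of them as columns ([common_neighbours_le]);
    if it lies beside the other one, the same holds with rows.  Either way the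
    longer side of the box is at least the number of common neighbours.

    The upper bounds come from explicit lists of rectangles, checked by
    evaluating a boolean test ([representsP]). *)

Section Proofs.
Local Set Implicit Arguments.
Local Unset Strict Implicit.
Import Order.TTheory GRing.Theory Num.Theory.
Import numFieldNormedType.Exports.
Local Open Scope ring_scope.
Local Open Scope classical_set_scope.
Local Notation rect := Defs.int_rect.

(** * Sight lines through unit strips *)

(** A direction [d] selects a coordinate, so that each argument about rows also
    covers columns: [lo d A] and [hi d A] bound the projection of [A] on that
    axis, and [~~ d] is the other axis. *)
Definition lo (d : bool) (A : rect) : int :=
  if d then Defs.left A else Defs.bottom A.
Definition hi (d : bool) (A : rect) : int :=
  if d then Defs.right A else Defs.top A.

Lemma lo_lt_hi d A : lo d A < hi d A.
Proof. by case: d => /=; [exact: left_lt_right|exact: bottom_lt_top]. Qed.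

(** [A] fills the unit strip where coordinate [d] runs from [t] to [t + 1]. *)
Definition covers d A (t : int) : bool := (lo d A <= t) && (t < hi d A).

Definition meet d A B : bool := (lo d A < hi d B) && (lo d B < hi d A).

Definition before d A B : bool := hi d A <= lo d B.

Definition between d A C B : bool :=
  before d A C && before d C B || before d B C && before d C A.

Lemma not_meet d A B : ~~ meet d A B = before d A B || before d B A.
Proof.
by rewrite /meet /before negb_and -!leNgt orbC.
Qed.

(** This is how a rectangle that meets a line of sight drawn from half a unit
    before the end of [A] to half a unit after the start of [B] is seen to lie
    between them. *)
Lemma inner_between d A B C :
  hi d A <= hi d C -> lo d C <= lo d B -> ~~ meet d C A -> ~~ meet d C B ->
  between d A C B.
Proof.
have := lo_lt_hi d A; have := lo_lt_hi d B; have := lo_lt_hi d C.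
rewrite !not_meet /between /before => hC hB hA h1 h2.
case/orP=> h3; first lia.
case/orP=> h4; last lia.
by rewrite h3 h4.
Qed.

Definition overlap A B : bool := meet true A B && meet false A B.

Definition disjoint_family (T : finType) (r : T -> rect) : Prop :=
  forall i j, i != j -> ~~ overlap (r i) (r j).

(** A line of sight inside strip [t]: coordinate [d] is constant along it. *)
Definition sight (T : finType) d (r : T -> rect) (i j : T) (t : int) : Prop :=
  [/\ covers d (r i) t, covers d (r j) t &
      forall k, k != i -> k != j -> covers d (r k) t ->
        ~~ between (~~ d) (r i) (r k) (r j)].

Lemma covers_lo d A : covers d A (lo d A).
Proof. by rewrite /covers lexx lo_lt_hi. Qed.

Lemma covers_meet d A B t : covers d A t -> covers d B t -> meet d A B.
Proof. rewrite /covers /meet; lia. Qed.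

Lemma betweenC d A C B : between d A C B = between d B C A.
Proof. by rewrite /between orbC. Qed.

Lemma sightC (T : finType) d (r : T -> rect) i j t :
  sight d r i j t -> sight d r j i t.
Proof.
move=> [ci cj blk]; split=> // k ki kj ck.
by rewrite betweenC; apply: blk.
Qed.

Lemma disjoint_not_meet (T : finType) (r : T -> rect) d i j :
  disjoint_family r -> i != j -> meet d (r i) (r j) ->
  ~~ meet (~~ d) (r i) (r j).
Proof.
by move=> dis ij; case: d => m; have := dis _ _ ij; rewrite /overlap m ?andbT.
Qed.

Lemma disjoint_before (T : finType) (r : T -> rect) d i j :
  disjoint_family r -> i != j -> meet d (r i) (r j) ->
  before (~~ d) (r i) (r j) || before (~~ d) (r j) (r i).
Proof. by move=> dis ij m; rewrite -not_meet; apply: disjoint_not_meet m. Qed.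

Definition coord {R : realType} (d : bool) (z : R * R) : R := if d then z.1 else z.2.
Definition point {R : realType} (d : bool) (u v : R) : R * R :=
  if d then (u, v) else (v, u).

Lemma coord_point {R : realType} d (u v : R) : coord d (point d u v) = u.
Proof. by case: d. Qed.

Lemma coordN_point {R : realType} d (u v : R) : coord (~~ d) (point d u v) = v.
Proof. by case: d. Qed.

Lemma mem_region (R : realType) A (z : R * R) :
  region R A z <-> forall d, (lo d A)%:~R <= coord d z <= (hi d A)%:~R.
Proof.
split=> [/in_rectangle[h1 h2 h3 h4] [] /=|h].
- by rewrite /lo /hi h1 h2.
- by rewrite /lo /hi h3 h4.
apply/in_rectangle.
by have /andP[h1 h2] := h true; have /andP[h3 h4] := h false.
Qed.

Lemma mem_interior (R : realType) A (z : R * R) :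
  ((region R A)°)%classic z <->
  forall d, (lo d A)%:~R < coord d z < (hi d A)%:~R.
Proof.
rewrite interior_region; split=> [[] /= + + [] /=|h].
- by rewrite !in_itv.
- by rewrite !in_itv.
by split=> /=; rewrite in_itv /=; [apply: (h true)|apply: (h false)].
Qed.

Definition segment {R : realType} (d : bool) (y a b : R) : set (R * R) :=
  [set z | coord d z = y /\ a <= coord (~~ d) z <= b].

Lemma axis_segmentP (R : realType) (s : set (R * R)) :
  axis_segment s <-> exists d y a b, a <= b /\ s = segment d y a b.
Proof.
have E1 (a b y : R) : `[a, b] `*` [set y] = segment false y a b.
  by apply/seteqP; split=> -[u v]; rewrite /segment /coord /= in_itv /=;
    move=> [].
have E2 (a b x : R) : [set x] `*` `[a, b] = segment true x a b.
  by apply/seteqP; split=> -[u v]; rewrite /segment /coord /= in_itv /=;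
    move=> [].
split=> [[[a [b [y [ab ->]]]]|[x [a [b [ab ->]]]]]|[[] [y [a [b [ab ->]]]]]].
- by exists false, y, a, b.
- by exists true, x, a, b.
- by right; exists y, a, b.
- by left; exists a, b, y.
Qed.

(** A line of sight at height [y] yields the strip [floor y]: a rectangle filling
    that strip contains the height [y], even when [y] is an integer, because
    regions are closed; and the two ends contain [y] in their interior, hence
    fill the strip. *)
Lemma sees_sight (R : realType) (T : finType) (r : T -> rect) i j :
  sees R r i j -> exists d t, sight d r i j t.
Proof.
move=> [s [/axis_segmentP[d [y [a [b [_ ->]]]]]]].
move=> [z [[zy /andP[za zb]] /mem_interior zi]].
move=> [w [[wy /andP[wa wb]] /mem_interior wj]] blk.
exists d, (Num.floor y).
have cv A : (lo d A)%:~R < y < (hi d A)%:~R -> covers d A (Num.floor y).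
  by move=> /andP[h1 h2]; rewrite /covers floor_ge_int floor_lt_int h2 ltW.
split.
- by apply: cv; rewrite -zy.
- by apply: cv; rewrite -wy.
move=> k ki kj /andP[]; rewrite floor_ge_int floor_lt_int => k1 k2.
apply/negP => bt; have := blk k ki kj.
have [v [av vb kv1 kv2]] : exists v : R, [/\ a <= v, v <= b,
    (lo (~~ d) (r k))%:~R <= v & v <= (hi (~~ d) (r k))%:~R].
  have /andP[zi1 zi2] := zi (~~ d); have /andP[wj1 wj2] := wj (~~ d).
  have kk : (lo (~~ d) (r k))%:~R < (hi (~~ d) (r k))%:~R :> R.
    by rewrite ltr_int lo_lt_hi.
  (* The side of the blocking rectangle facing the other two is on the segment. *)
  exists (lo (~~ d) (r k))%:~R.
  case/orP: bt => /andP[]; rewrite /before -!(ler_int R) => b1 b2;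
    split; lra.
apply/eqP/set0P; exists (point d y v).
split; first by rewrite /segment /= coord_point coordN_point av vb.
apply/mem_region => e; case: (eqVneq e d) => [->|ed].
  by rewrite coord_point k1 (ltW k2).
have -> : e = ~~ d by case: e d ed {av vb kv1 kv2 bt k1 k2 zi wj cv
  zy za zb wy wa wb blk} => [] [].
by rewrite coordN_point kv1 kv2.
Qed.

Lemma sees_sym (R : realType) (T : finType) (r : T -> rect) i j :
  sees R r i j -> sees R r j i.
Proof. by move=> [s [? ? ? b]]; exists s; split=> // k ki kj; apply: b. Qed.

(** The line of sight is drawn in the middle of the strip, and reaches half a unit
    into the two rectangles. *)
Lemma sight_sees (R : realType) (T : finType) (r : T -> rect) d i j t :
  disjoint_family r -> i != j -> sight d r i j t -> sees R r i j.
Proof.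
move=> dis ij.
wlog bf : i j ij / before (~~ d) (r i) (r j).
  move=> hw st; have [ci cj _] := st.
  have /orP[bf|bf] := disjoint_before dis ij (covers_meet ci cj).
    exact: hw.
  by apply: sees_sym; apply: hw (sightC st); rewrite // eq_sym.
move=> [ci cj blk].
have ltS (m n : int) : m < n -> m%:~R + 1 <= n%:~R :> R.
  by move=> mn; rewrite -intrD1 ler_int lezD1.
have le_half (m n : int) : m%:~R <= n%:~R + 2^-1 :> R -> m <= n.
  by move=> h; rewrite leNgt; apply/negP => /ltS; lra.
have half_lt (m n : int) : m%:~R + 2^-1 <= n%:~R :> R -> m < n.
  by move=> h; rewrite ltNge -(ler_int R); lra.
pose y : R := t%:~R + 2^-1.
pose a : R := (hi (~~ d) (r i))%:~R - 2^-1.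
pose b : R := (lo (~~ d) (r j))%:~R + 2^-1.
have in_strip (A : rect) : covers d A t ->
    (lo d A)%:~R < y < (hi d A)%:~R.
  by move=> /andP[]; rewrite -(ler_int R) => h1 /ltS h2; rewrite /y; lra.
have ab : a <= b by move: bf; rewrite /before -(ler_int R) /a /b; lra.
have /ltS iI := lo_lt_hi (~~ d) (r i).
have /ltS jI := lo_lt_hi (~~ d) (r j).
have inI (A : rect) (v : R) : covers d A t ->
    (lo (~~ d) A)%:~R < v < (hi (~~ d) A)%:~R ->
    ((region R A)°)%classic (point d y v).
  move=> cA vA; apply/mem_interior => e; case: (eqVneq e d) => [->|ed].
    by rewrite coord_point in_strip.
  have -> : e = ~~ d by case: e (d) ed => [] [].
  by rewrite coordN_point.
exists (segment d y a b); split.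
- by apply/axis_segmentP; exists d, y, a, b.
- exists (point d y a); split; last by apply: inI => //; rewrite /a; lra.
  by rewrite /segment /= coord_point coordN_point lexx ab.
- exists (point d y b); split; last by apply: inI => //; rewrite /b; lra.
  by rewrite /segment /= coord_point coordN_point lexx ab.
move=> k ki kj; apply/eqP/negPn/negP => /set0P[z [[zy /andP[za zb]]]].
move=> /mem_region zk.
have /andP[k1 k2] := zk d; have /andP[k3 k4] := zk (~~ d).
have ck : covers d (r k) t.
  by rewrite /covers le_half ?half_lt //; rewrite -/y -zy.
have kj' : lo (~~ d) (r k) <= lo (~~ d) (r j).
  by apply: le_half; exact: le_trans k3 zb.
have ki' : hi (~~ d) (r i) <= hi (~~ d) (r k).
  by apply: le_half; rewrite -lerBlDr; exact: le_trans za k4.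
have mi := disjoint_not_meet dis ki (covers_meet ck ci).
have mj := disjoint_not_meet dis kj (covers_meet ck cj).
by have /negP[] := blk k ki kj ck; apply: inner_between.
Qed.

Local Close Scope classical_set_scope.

Lemma interiors_disjointP (R : realType) (A B : rect) :
  ((region R A)° `&` (region R B)° = set0)%classic <-> ~~ overlap A B.
Proof.
split=> [AB|].
  apply/negP => /andP[mt mf].
  have mid d : meet d A B -> exists v : R,
      (lo d A)%:~R < v < (hi d A)%:~R /\ (lo d B)%:~R < v < (hi d B)%:~R.
    rewrite /meet -!(ltr_int R) => /andP[h1 h2].
    have := lo_lt_hi d A; have := lo_lt_hi d B; rewrite -!(ltr_int R) => hB hA.
    have [le|lt] := lerP (lo d A)%:~R ((lo d B)%:~R : R).
      have [le'|lt'] := lerP (hi d A)%:~R ((hi d B)%:~R : R).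
        by exists (((lo d B)%:~R + (hi d A)%:~R) / 2); split; lra.
      by exists (((lo d B)%:~R + (hi d B)%:~R) / 2); split; lra.
    have [le'|lt'] := lerP (hi d A)%:~R ((hi d B)%:~R : R).
      by exists (((lo d A)%:~R + (hi d A)%:~R) / 2); split; lra.
    by exists (((lo d A)%:~R + (hi d B)%:~R) / 2); split; lra.
  have [u [uA uB]] := mid _ mt; have [v [vA vB]] := mid _ mf.
  suff : (@classical_sets.set0 (R * R)) (u, v) by [].
  by rewrite -AB; split; apply/mem_interior => -[].
move=> /negP ov; rewrite -subset0 => z [/mem_interior zA /mem_interior zB].
apply: ov; apply/andP; split; [have := zA true; have := zB true|
  have := zA false; have := zB false] => /andP[h1 h2] /andP[h3 h4];
  by rewrite /meet -!(ltr_int R); apply/andP; split; lra.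
Qed.

Definition strip_representation (G : graph) (r : G -> rect) : Prop :=
  disjoint_family r /\
  forall i j : G, i != j -> (edge i j <-> exists d t, sight d r i j t).

(** Real lines of sight can be moved to the middle of a strip, so the reals
    disappear from the problem. *)
Lemma strip_representationP (R : realType) (G : graph) (r : G -> rect) :
  RV_representation R r <-> strip_representation r.
Proof.
split=> -[dis adj].
  have dis' : disjoint_family r.
    by move=> i j ij; apply/(interiors_disjointP R); apply: dis.
  split=> // i j ij; rewrite adj //; split; first exact: sees_sight.
  by move=> [d [t]]; apply: sight_sees.
split=> i j ij; first by apply/interiors_disjointP; apply: dis.
rewrite adj //; split; last exact: sees_sight.
by move=> [d [t]]; apply: sight_sees.
Qed.

Lemma edge_neq {G : graph} (i j : G) : edge i j -> i != j.
Proof. by move=> ij; apply/eqP => E; rewrite E edge_irr in ij. Qed.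

(** * Counting strips in a bounding box *)

Definition extent (d : bool) (B : rect) : nat := `|hi d B - lo d B|%N.

Definition encloses (B : rect) (T : finType) (r : T -> rect) : Prop :=
  forall d i, lo d B <= lo d (r i) /\ hi d (r i) <= hi d B.

Lemma strip_index (T : finType) (r : T -> rect) B d i t :
  encloses B r -> covers d (r i) t ->
  exists u : 'I_(extent d B), lo d B + u%:Z = t.
Proof.
move=> /(_ d i)[h1 h2] /andP[h3 h4].
have tu : (`|t - lo d B| < extent d B)%N by rewrite /extent; lia.
by exists (Ordinal tu) => /=; lia.
Qed.

(** Rectangles consecutive in a strip see each other, so moving along the strip
    one stays in a class closed under adjacency.  The induction is on the
    distance of the two rectangles along the strip. *)
Lemma same_strip_same_class (G : graph) (K : eqType) (f : G -> K)
    (r : G -> rect) d t i j :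
  strip_representation r -> (forall i j, edge i j -> f i = f j) ->
  covers d (r i) t -> covers d (r j) t -> f i = f j.
Proof.
move=> [dis adj] fE.
have [n] := ubnP `|lo (~~ d) (r j) - lo (~~ d) (r i)|%N.
elim: n i j => // n IHn i j; wlog bf : i j / before (~~ d) (r i) (r j).
  move=> hw le ci cj; have [->//|ij] := eqVneq i j.
  have /orP[bf|bf] := disjoint_before dis ij (covers_meet ci cj).
    exact: hw.
  by symmetry; apply: hw; rewrite // distnC.
move=> le ci cj; have [->//|ij] := eqVneq i j.
have [|no] := boolP [exists k, [&& k != i, k != j, covers d (r k) t &
    between (~~ d) (r i) (r k) (r j)]].
  move=> /existsP[k /and4P[ki kj ck bt]].
  have := lo_lt_hi (~~ d) (r i); have := lo_lt_hi (~~ d) (r j).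
  have := lo_lt_hi (~~ d) (r k).
  move=> hk hj hi'.
  have [ik kj'] : hi (~~ d) (r i) <= lo (~~ d) (r k) /\
                  hi (~~ d) (r k) <= lo (~~ d) (r j).
    move: bt bf; rewrite /between /before => /orP[] /andP[h1 h2] h3; first by [].
    by exfalso; move: h1 h2 h3 hk hj hi'; clear; lia.
  rewrite (IHn i k) // ?(IHn k j) //;
    by move: le ik kj' hk hj hi'; clear; lia.
apply/fE/(adj _ _ ij); exists d, t; split=> // k ki kj ck.
apply: contra no => bt; apply/existsP; exists k.
by rewrite ki kj ck bt.
Qed.

Definition class_strips (T K : finType) (f : T -> K) (r : T -> rect) d B c :
    {set 'I_(extent d B)} :=
  [set t : 'I_(extent d B) |
    [exists i, (f i == c) && covers d (r i) (lo d B + (t : nat)%:Z)]].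

Lemma class_strips_lo (T K : finType) (f : T -> K) (r : T -> rect) d B i :
  encloses B r -> exists2 u, u \in class_strips f r d B (f i) &
    lo d B + (u : nat)%:Z = lo d (r i).
Proof.
move=> en; have [u uE] := strip_index en (covers_lo d (r i)).
exists u => //; rewrite inE; apply/existsP; exists i.
by rewrite eqxx uE covers_lo.
Qed.

(** No strip is used by two classes. *)
Lemma class_strips_sum (G : graph) (K : finType) (f : G -> K) (r : G -> rect)
    d B :
  strip_representation r -> (forall i j, edge i j -> f i = f j) ->
  (\sum_c #|class_strips f r d B c| <= extent d B)%N.
Proof.
move=> rep fE.
have sumE c : #|class_strips f r d B c| =
    (\sum_(t : 'I_(extent d B)) (t \in class_strips f r d B c))%N.
  by rewrite -sum1_card big_mkcond; apply: eq_bigr => t _; case: (t \in _).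
rewrite (eq_bigr _ (fun c _ => sumE c)) exchange_big /=.
rewrite -[leqRHS]card_ord -sum1_card; apply: leq_sum => t _.
have [c0 c0t|no] := pickP (fun c => t \in class_strips f r d B c); last first.
  by rewrite big1 // => c _; rewrite no.
rewrite (bigD1 c0) //= c0t big1 // => c cc0; apply/eqP; rewrite eqb0.
apply: contra cc0 => ct; move: ct c0t; rewrite !inE.
move=> /existsP[i /andP[/eqP <- ci]] /existsP[j /andP[/eqP <- cj]].
by apply/eqP; apply: same_strip_same_class rep fE ci cj.
Qed.

(** Distinct rectangles of a class have distinct lower left corners. *)
Lemma card_class_le (T K : finType) (f : T -> K) (r : T -> rect) B c :
  disjoint_family r -> encloses B r ->
  (#|[set i | f i == c]| <=
   #|class_strips f r true B c| * #|class_strips f r false B c|)%N.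
Proof.
move=> dis en; rewrite -cardsX.
have lo_strip d i : {u | u \in class_strips f r d B (f i) &
    lo d B + (u : nat)%:Z = lo d (r i)}.
  by apply: cid2; apply: class_strips_lo.
pose corner i := (s2val (lo_strip true i), s2val (lo_strip false i)).
have cornerE d i : lo d (r i) = lo d B + (s2val (lo_strip d i) : nat)%:Z.
  by rewrite (s2valP' (lo_strip d i)).
have inj : injective corner.
  move=> i j [e1 e2]; apply/eqP/negPn/negP => /dis /negP[]; apply/andP.
  have eqlo d : s2val (lo_strip d i) = s2val (lo_strip d j) -> meet d (r i) (r j).
    move=> e; apply: covers_meet (covers_lo _ _) _.
    by rewrite (cornerE d i) e -(cornerE d j) covers_lo.
  by split; apply: eqlo.
rewrite -(card_imset _ inj); apply: subset_leq_card.
apply/fintype.subsetP => _ /imsetP[i + ->]; rewrite inE => /eqP <-.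
by rewrite finset.in_setX /= (s2valP (lo_strip true i)) (s2valP (lo_strip false i)).
Qed.

Lemma other_direction (d e : bool) : e != d -> e = ~~ d.
Proof. by case: d e => [] []. Qed.

Lemma sight_meet (T : finType) (r : T -> rect) d i j t :
  sight d r i j t -> meet d (r i) (r j).
Proof. by move=> [ci cj _]; apply: covers_meet ci cj. Qed.

(** Disjoint rectangles share a strip in one direction at most, and this
    decides the direction of their lines of sight. *)
Lemma sight_along (T : finType) (r : T -> rect) d d' i j t :
  disjoint_family r -> i != j -> ~~ meet (~~ d) (r i) (r j) ->
  sight d' r i j t -> sight d r i j t.
Proof.
move=> dis ij nm st; have [<-//|/other_direction d'd] := eqVneq d' d.
by move: st (sight_meet st); rewrite d'd => _ m; rewrite m in nm.
Qed.

(** The middle one of three rectangles of a strip separates the other two. *)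
Lemma triangle_not_in_strip (G : graph) (r : G -> rect) d t (i j k : G) :
  strip_representation r -> edge i j -> edge j k -> edge i k ->
  ~ (forall x, x \in [:: i; j; k] -> lo d (r x) = t /\ hi d (r x) = t + 1).
Proof.
move=> [dis adj] ij jk ik strip.
have cov x : x \in [:: i; j; k] -> covers d (r x) t.
  by move=> /strip[l h]; rewrite /covers l h; lia.
pose s := [:: i; j; k].
(* The two rectangles of an edge share the strip, so they see each other along
   it, and the third one is not between them. *)
have open x y z : x \in s -> y \in s -> z \in s -> edge x y ->
    z != x -> z != y -> ~~ between (~~ d) (r x) (r z) (r y).
  move=> xs ys zs xy zx zy.
  have [d' [t' st]] := (adj _ _ (edge_neq xy)).1 xy.
  have m : meet d (r x) (r y) := covers_meet (cov _ xs) (cov _ ys).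
  have nm := disjoint_not_meet dis (edge_neq xy) m.
  have [cx cy blk] := sight_along dis (edge_neq xy) nm st; apply: blk => //.
  have [l h] := strip _ zs; have [lx hx] := strip _ xs.
  by move: cx; rewrite /covers l h lx hx.
have [iS jS kS] : [/\ i \in s, j \in s & k \in s].
  by rewrite !inE !eqxx !orbT.
have neq (x y : G) : edge x y -> x != y /\ y != x.
  by move=> /edge_neq xy; split=> //; rewrite eq_sym.
have [nij nji] := neq _ _ ij; have [njk nkj] := neq _ _ jk.
have [nik nki] := neq _ _ ik.
have o1 := open i j k iS jS kS ij nki nkj.
have o2 := open j k i jS kS iS jk nij nik.
have o3 := open i k j iS kS jS ik nji njk.
have b1 := disjoint_before dis nij (covers_meet (cov i iS) (cov j jS)).
have b2 := disjoint_before dis njk (covers_meet (cov j jS) (cov k kS)).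
have b3 := disjoint_before dis nik (covers_meet (cov i iS) (cov k kS)).
move: o1 o2 o3 b1 b2 b3; rewrite /between.
case: (before _ (r i) (r j)); case: (before _ (r j) (r i));
case: (before _ (r j) (r k)); case: (before _ (r k) (r j));
by case: (before _ (r i) (r k)); case: (before _ (r k) (r i)).
Qed.

Lemma triangle_class_strips (G : graph) (K : finType) (f : G -> K)
    (r : G -> rect) d B (i j k : G) :
  strip_representation r -> encloses B r -> (forall i j, edge i j -> f i = f j) ->
  edge i j -> edge j k -> edge i k ->
  (2 <= #|class_strips f r d B (f i)|)%N.
Proof.
move=> rep en fE ij jk ik; rewrite ltnNge; apply/negP => le1.
have fx x : x \in [:: i; j; k] -> f x = f i.
  by rewrite !inE => /or3P[] /eqP -> //; [rewrite (fE _ _ ij)|rewrite (fE _ _ ik)].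
apply: (@triangle_not_in_strip G r d (lo d (r i)) i j k) => // x xs.
have [u uS uE] := class_strips_lo f d i en.
(* Every strip covered by x is the one strip of the class. *)
have only t : covers d (r x) t -> t = lo d (r i).
  move=> ct; have [v vE] := strip_index en ct.
  have vS : v \in class_strips f r d B (f i).
    by rewrite inE; apply/existsP; exists x; rewrite fx // eqxx vE ct.
  by rewrite -vE -uE; congr (_ + Posz (nat_of_ord _)); apply: (card_le1_eqP le1).
have lt := lo_lt_hi d (r x).
have l : lo d (r x) = lo d (r i) by apply: only; rewrite covers_lo.
split=> //; rewrite -(only (hi d (r x) - 1)); first by lia.
by rewrite /covers; lia.
Qed.

(** * Common neighbours *)

Definition common_neighbours (G : graph) (a b : G) : {set G} :=
  [set c | edge a c && edge b c].

(** With [a] below [b], each common neighbour [c] claims a column: one in which it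
    is seen from [b] when it lies below [b]; otherwise one in which it is seen
    from [a], which [c] then lies above; and if it lies beside both, any column
    it covers.  In the last case [c] extends from below the top of [a] to above
    the bottom of [b], so two such neighbours share a row and no column. *)
Lemma common_neighbours_le (G : graph) (r : G -> rect) d B (a b : G) :
  strip_representation r -> encloses B r -> before d (r a) (r b) ->
  (#|common_neighbours a b| <= extent (~~ d) B)%N.
Proof.
move=> [dis adj] en ab; set e := ~~ d.
have Ne : ~~ e = d by rewrite /e negbK.
have ltA := lo_lt_hi d (r a); have ltB := lo_lt_hi d (r b).
have ba : b != a.
  by apply/eqP => E; move: ab ltB; rewrite E /before; lia.
pose below (c : G) (x : int) := sight e r c b x /\ before d (r c) (r b).
pose above (c : G) (x : int) :=
  [/\ sight e r c a x, before d (r a) (r c) & ~~ covers e (r b) x].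
pose beside (c : G) (x : int) :=
  [/\ covers e (r c) x, meet d (r c) (r a) & meet d (r c) (r b)].
pose claims c x := [\/ below c x, above c x | beside c x].
have has_claim (c : G) : edge a c && edge b c -> exists x, claims c x.
  rewrite ![edge _ c]edge_sym => /andP[ca cb].
  have [nca ncb] := (edge_neq ca, edge_neq cb).
  have [da [ta sa]] := (adj _ _ nca).1 ca.
  have [db [tb sb]] := (adj _ _ ncb).1 cb.
  have ltC := lo_lt_hi d (r c).
  have [mb|nmb] := boolP (meet d (r c) (r b)).
    have [ma|nma] := boolP (meet d (r c) (r a)).
      by exists (lo e (r c)); apply: Or33; split=> //; apply: covers_lo.
    have {}sa : sight e r c a ta by apply: sight_along sa; rewrite ?Ne.
    exists ta; apply: Or32; split=> //.
      by move: mb ab nma; rewrite not_meet /meet /before; clear -ltA ltB ltC; lia.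
    apply/negP => cbt; have [cct _ _] := sa.
    by have /negP[] := disjoint_not_meet dis ncb mb; apply: covers_meet cbt.
  have {}sb : sight e r c b tb by apply: sight_along sb; rewrite ?Ne.
  move: (nmb); rewrite not_meet => /orP[cb'|bc]; first by exists tb; apply: Or31.
  have ac : before d (r a) (r c).
    by move: ab bc; rewrite /before; clear -ltB; lia.
  have {}sa : sight e r c a ta.
    by apply: sight_along sa; rewrite ?Ne // not_meet ac orbT.
  exists ta; apply: Or32; split=> //.
  apply/negP => cbt; have [_ _ blk] := sa.
  have nbc : b != c by rewrite eq_sym.
  have /negP[] := blk b nbc ba cbt.
  by rewrite Ne /between ab bc orbT.
(* A column holds at most one claim of each kind, since the claimant is the
   rectangle of the column nearest to b, nearest to a, or level with both; and
   claims of different kinds never share a column. *)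
have level (c c' : G) x : c != c' -> covers e (r c) x -> covers e (r c') x ->
    before d (r c) (r c') \/ before d (r c') (r c).
  move=> cc' cx cx'; apply/orP; rewrite -Ne.
  exact: disjoint_before dis cc' (covers_meet cx cx').
have not_both (c c' : G) x : c != c' -> meet d (r c) (r c') ->
    covers e (r c) x -> covers e (r c') x -> False.
  move=> cc' m cx cx'; move: (disjoint_not_meet dis cc' m).
  by rewrite -/e (covers_meet cx cx').
have claims_inj (c c' : G) x : edge a c && edge b c -> edge a c' && edge b c' ->
    claims c x -> claims c' x -> c = c'.
  move=> /andP[ac bc] /andP[ac' bc'] cl cl'.
  have [//|cc'] := eqVneq c c'; exfalso.
  have c'c : c' != c by rewrite eq_sym.
  have nca : c != a by rewrite eq_sym edge_neq.
  have ncb : c != b by rewrite eq_sym edge_neq.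
  have nca' : c' != a by rewrite eq_sym edge_neq.
  have ncb' : c' != b by rewrite eq_sym edge_neq.
  case: cl cl' => [[[cx bx blk] cb]|[[cx ax blk] ca nbx]|[cx ma mb]]
    [[[cx' bx' blk'] cb']|[[cx' ax' blk'] ca' nbx']|[cx' ma' mb']].
  - have [lt|lt] := level _ _ _ cc' cx cx'.
      by have := blk _ c'c ncb' cx'; rewrite Ne /between lt cb'.
    by have := blk' _ cc' ncb cx; rewrite Ne /between lt cb.
  - by rewrite bx in nbx'.
  - exact: not_both ncb' mb' cx' bx.
  - by rewrite bx' in nbx.
  - have [lt|lt] := level _ _ _ cc' cx cx'.
      by have := blk' _ cc' nca cx; rewrite Ne /between lt ca orbT.
    by have := blk _ c'c nca' cx'; rewrite Ne /between lt ca' orbT.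
  - exact: not_both nca' ma' cx' ax.
  - exact: not_both ncb mb cx bx'.
  - exact: not_both nca ma cx ax'.
  - apply: (not_both c c' x) => //.
    by move: ma mb ma' mb' ab; rewrite /meet /before; clear; lia.
have claim_strip (c : G) : edge a c && edge b c ->
    exists u : 'I_(extent e B), claims c (lo e B + (u : nat)%:Z).
  move=> /has_claim[x cx].
  have xc : covers e (r c) x by case: cx => [[[]]|[[]]|[]].
  by have [u uE] := strip_index en xc; exists u; rewrite uE.
have [->|[c0 c0N]] := set_0Vmem (common_neighbours a b); first by rewrite cards0.
have [u0 _] : exists u : 'I_(extent e B), True.
  by move: c0N; rewrite inE => /claim_strip[u _]; exists u.
have total_claim (c : G) : exists u : 'I_(extent e B),
    edge a c && edge b c -> claims c (lo e B + (u : nat)%:Z).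
  have [/claim_strip[u cu]|_] := boolP (edge a c && edge b c); first by exists u.
  by exists u0.
have [phi phiP] := choice total_claim.
rewrite -[leqRHS]card_ord; apply: (@leq_card_in _ _ phi).
move=> c c'; rewrite !inE => cN cN' E.
by apply: claims_inj (phiP _ cN) _ => //; rewrite E; apply: phiP.
Qed.

(** * Minimal bounding boxes *)

Definition size_param (p : parameter) (a b : nat) : nat :=
  match p with
  | Area => (a * b)%N
  | Perimeter => (2 * (a + b))%N
  | Height => minn a b
  | Width => maxn a b
  end.

Lemma size_param_le p a b a' b' :
  (a <= a')%N -> (b <= b')%N -> (size_param p a b <= size_param p a' b')%N.
Proof. by case: p => /= aa' bb'; rewrite ?leq_mul //; lia. Qed.

Lemma box_paramE p B : box_param p B = size_param p (extent true B) (extent false B).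
Proof. by []. Qed.

Lemma region_sub (R : realType) (A B : rect) :
  (region R A `<=` region R B)%classic <->
  forall d, lo d B <= lo d A /\ hi d A <= hi d B.
Proof.
split=> [sub d|bnd z /mem_region zA].
  have [lA hA] : (lo true A <= hi true A) /\ (lo false A <= hi false A).
    by split; apply/ltW/lo_lt_hi.
  have /mem_region/(_ d) : region R B ((lo true A)%:~R, (lo false A)%:~R).
    by apply/sub/mem_region => -[]; rewrite /coord /= lexx ler_int.
  have /mem_region/(_ d) : region R B ((hi true A)%:~R, (hi false A)%:~R).
    by apply/sub/mem_region => -[]; rewrite /coord /= lexx ler_int ?andbT.
  by case: d; rewrite /coord /= !ler_int => /andP[_ ->] /andP[->].
apply/mem_region => d; have /andP[z1 z2] := zA d; have [h1 h2] := bnd d.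
by rewrite (le_trans _ z1) ?(le_trans z2) // ler_int.
Qed.

Lemma bounding_box_encloses (R : realType) (T : finType) (r : T -> rect) B :
  bounding_box R r B -> encloses B r.
Proof. by move=> [sub _] d i; have /region_sub := sub i. Qed.

Lemma bounding_box_le (R : realType) (T : finType) (r : T -> rect) B C d :
  bounding_box R r B -> encloses C r -> (extent d B <= extent d C)%N.
Proof.
move=> [_ minB] en.
have /region_sub/(_ d)[h1 h2] : (region R B `<=` region R C)%classic.
  by apply: minB => i; apply/region_sub => d'; apply: en.
have := lo_lt_hi d B; rewrite /extent; lia.
Qed.

Lemma graph_param_le (R : realType) p (G : graph) (r : G -> rect) C :
  (0 < #|G|)%N -> strip_representation r -> encloses C r ->
  (graph_param R p G <= size_param p (extent true C) (extent false C))%N.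
Proof.
move=> G0 rep en; have rv := (strip_representationP R r).2 rep.
have [B bB] := bounding_box_ex R r G0.
have [_ /(_ (box_param p B)) min] := graph_paramP p (ex_intro _ r rv) G0.
apply: leq_trans (min _) _; first by exists r, B.
by rewrite box_paramE size_param_le ?(bounding_box_le _ bB).
Qed.

Lemma graph_param_ge (R : realType) p (G : graph) m :
  (0 < #|G|)%N -> RVG R G ->
  (forall (r : G -> rect) B, strip_representation r -> encloses B r ->
    (m <= size_param p (extent true B) (extent false B))%N) ->
  (m <= graph_param R p G)%N.
Proof.
move=> G0 rv bnd; have [[r [B [rep bB <-]]] _] := graph_paramP p rv G0.
apply: bnd; last exact: bounding_box_encloses bB.
exact: (strip_representationP R r).1 rep.
Qed.

(** * Graphs on initial segments of the natural numbers *)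

(** Taking the symmetric, irreflexive closure of [e] lets any relation on the
    natural numbers define a graph. *)
Definition nat_edge (n : nat) (e : rel nat) : rel 'I_n :=
  fun i j => (i != j) && (e i j || e j i).

Lemma nat_edge_sym n e : symmetric (@nat_edge n e).
Proof. by move=> i j; rewrite /nat_edge eq_sym orbC. Qed.

Lemma nat_edge_irr n e : irreflexive (@nat_edge n e).
Proof. by move=> i; rewrite /nat_edge eqxx. Qed.

Definition nat_graph n e : graph := Graph (@nat_edge_sym n e) (@nat_edge_irr n e).

Lemma tile_lt (x a : nat) : x%:Z < (x + a.+1)%N.
Proof. lia. Qed.

(** The sides are [a + 1] and [b + 1], so that no positivity proof has to be
    supplied. *)
Definition tile (x y a b : nat) : rect := IntRect (tile_lt x a) (tile_lt y b).

Lemma extent_tile d x y a b :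
  extent d (tile x y a b) = if d then a.+1 else b.+1.
Proof. by rewrite /extent; case: d => /=; lia. Qed.

(** Vertices range over a list of numbers rather than over ordinals, so that the
    test can be evaluated. *)
Definition sightb n d (r : nat -> rect) (i j : nat) (t : nat) : bool :=
  [&& covers d (r i) t, covers d (r j) t &
      all (fun k => [|| k == i, k == j, ~~ covers d (r k) t |
                        ~~ between (~~ d) (r i) (r k) (r j)]) (iota 0 n)].

(** The test covers all strips of the box with sides [W + 1] and [H + 1], and the
    rectangles fill no other strip. *)
Definition represents n (e : rel nat) (r : nat -> rect) (W H : nat) : bool :=
  all (fun i => [&& 0 <= lo true (r i), hi true (r i) <= W.+1%N,
                    0 <= lo false (r i) & hi false (r i) <= H.+1%N]) (iota 0 n) &&
  all (fun i => all (fun j => (i == j) || ~~ overlap (r i) (r j) &&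
    ((e i j || e j i) ==
     has (fun t => sightb n true r i j t) (iota 0 W.+1) ||
     has (fun t => sightb n false r i j t) (iota 0 H.+1)))
  (iota 0 n)) (iota 0 n).

Lemma all_iotaP n (P : pred nat) : all P (iota 0 n) -> forall i : 'I_n, P i.
Proof. by move=> /allP h i; apply: h; rewrite mem_iota /=. Qed.

Lemma representsP n e r W H : represents n e r W H ->
  strip_representation (r : nat_graph n e -> rect) /\
  encloses (tile 0 0 W H) (r : nat_graph n e -> rect).
Proof.
move=> /andP[/all_iotaP box /all_iotaP pairs].
have en : encloses (tile 0 0 W H) (fun i : 'I_n => r i).
  by move=> d i; have /and4P[? ? ? ?] := box i; case: d.
have pair (i j : 'I_n) : i != j -> ~~ overlap (r i) (r j) &&
    ((e i j || e j i) ==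
     has (fun t => sightb n true r i j t) (iota 0 W.+1) ||
     has (fun t => sightb n false r i j t) (iota 0 H.+1)).
  move=> ij; have /all_iotaP/(_ j) := pairs i.
  by rewrite (inj_eq val_inj) (negbTE ij).
have sightbP d (i j : 'I_n) (t : nat) :
    sightb n d r i j t <-> sight d (fun k : 'I_n => r k) i j t.
  split=> [/and3P[ci cj /all_iotaP blk]|[ci cj blk]].
    split=> // k ki kj ck; have := blk k.
    by rewrite !(inj_eq val_inj) (negbTE ki) (negbTE kj) ck.
  rewrite /sightb ci cj /=; apply/allP => k; rewrite mem_iota /= => kn.
  have := blk (Ordinal kn); rewrite -!(inj_eq val_inj) /=.
  by do 2![case: eqP => //= _]; case: covers => //= ->.
split=> //; split=> [i j /pair/andP[]//|i j ij].
have /andP[_ /eqP E] := pair i j ij.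
rewrite /edge /= /nat_edge ij E; split.
  by case/orP => /hasP[t _ /sightbP st]; [exists true, t|exists false, t].
move=> [d [t st]]; have [ci _ _] := st.
have [u uE] := strip_index en ci.
have {}uE : t = (u : nat)%:Z.
  have lo0 : lo d (tile 0 0 W H) = 0 by case: (d).
  by rewrite -uE lo0 add0r.
have un : (u < if d then W.+1 else H.+1)%N.
  by rewrite -(extent_tile d 0 0 W H).
move: st; rewrite uE => /sightbP st; apply/orP.
move: (nat_of_ord u) st un => v.
by case: (d) => st vn; [left|right]; apply/hasP; exists v; rewrite ?mem_iota.
Qed.

Lemma nat_graph_RVG (R : realType) n e r W H :
  represents n e r W H -> RVG R (nat_graph n e).
Proof.
move=> /representsP[rep _]; exists (fun i : 'I_n => r i).
exact: (strip_representationP R _).2 rep.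
Qed.

Lemma nat_graph_param_le (R : realType) p n e r W H :
  represents n.+1 e r W H ->
  (graph_param R p (nat_graph n.+1 e) <= size_param p W.+1 H.+1)%N.
Proof.
move=> /representsP[rep en].
have := graph_param_le R p _ rep en; rewrite !extent_tile.
by apply; rewrite card_ord.
Qed.

(** * The four graphs *)

(** Vertices 0 to 11 form the path and 12, 13 are the two hubs. *)
Definition double_fan_edge : rel nat :=
  fun i j => (j == i.+1) && (j < 12)%N || (i < 12 <= j)%N.
Definition double_fan := nat_graph 14 double_fan_edge.

(** The path fills the middle one of three rows; each hub fills another row. *)
Definition double_fan_rect (i : nat) : rect :=
  if (i < 12)%N then tile i 1 0 0 else tile 0 (2 * (i - 12)) 11 0.

(** A disjoint union of cliques, one for each value of [key]. *)
Definition cluster (key : nat -> nat) := nat_graph 14 (fun i j => key i == key j).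

Definition matching_key (i : nat) : nat := (i %/ 2)%N.

(** The truncated differences in this key and the next one take over from 12 on,
    and make 12 and 13 isolated vertices. *)
Definition near_matching_key (i : nat) : nat := maxn (i %/ 2) (i - 6).
Definition triangles_key (i : nat) : nat := maxn (i %/ 3) (i - 8).

(** Vertex [i] is the unit square in column [i] and in the row of its class. *)
Definition row_rect (key : nat -> nat) (i : nat) : rect := tile i (key i) 0 0.

(** Squares of side 2 and 1 along a diagonal; a square of side 2 is cut into its
    lower half and two unit squares, which are pairwise adjacent. *)
Definition triangles_rect (i : nat) : rect :=
  let o := (2 * (i %/ 3))%N in
  if (12 <= i)%N then tile (i - 4) (i - 4) 0 0
  else match (i %% 3)%N with
       | 0 => tile o o 1 0
       | 1 => tile o o.+1 0 0
       | _ => tile o.+1 o.+1 0 0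
       end.

Lemma double_fan_represents : represents 14 double_fan_edge double_fan_rect 11 2.
Proof. by vm_compute. Qed.

Lemma matching_represents :
  represents 14 (fun i j => matching_key i == matching_key j)
    (row_rect matching_key) 13 6.
Proof. by vm_compute. Qed.

Lemma near_matching_represents :
  represents 14 (fun i j => near_matching_key i == near_matching_key j)
    (row_rect near_matching_key) 13 7.
Proof. by vm_compute. Qed.

Lemma triangles_represents :
  represents 14 (fun i j => triangles_key i == triangles_key j) triangles_rect 9 9.
Proof. by vm_compute. Qed.

Lemma double_fan_box (r : double_fan -> rect) B :
  strip_representation r -> encloses B r ->
  (12 <= maxn (extent true B) (extent false B))%N.
Proof.
move=> rep en.
pose a : double_fan := @inord 13 12; pose b : double_fan := @inord 13 13.
have twelve : (12 <= #|common_neighbours a b|)%N.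
  have inj : injective (widen_ord (isT : (12 <= 14)%N)).
    by move=> i j /(congr1 val) /= /val_inj.
  rewrite -[leqLHS](card_ord 12) -(card_imset _ inj); apply: subset_leq_card.
  apply/fintype.subsetP => _ /imsetP[i _ ->]; rewrite inE /edge /= /nat_edge.
  have i12 := ltn_ord i.
  by rewrite -!(inj_eq val_inj) /double_fan_edge /= !inordK //; lia.
have twelveC : (12 <= #|common_neighbours b a|)%N.
  apply: leq_trans twelve (subset_leq_card _).
  by apply/fintype.subsetP => c; rewrite !inE andbC.
have ab : a != b by rewrite -(inj_eq val_inj) /= !inordK.
have le12 d : ~~ meet d (r a) (r b) -> (12 <= extent (~~ d) B)%N.
  by rewrite not_meet => /orP[] /(common_neighbours_le rep en); apply: leq_trans.
have := rep.1 _ _ ab; rewrite /overlap negb_and leq_max.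
by case/orP => /le12 /= ->; rewrite ?orbT.
Qed.

Definition cluster_class key m (i : cluster key) : 'I_m.+1 :=
  inord (key (i : 'I_14)).

Lemma cluster_edgeE key (i j : cluster key) :
  edge i j = (i != j) && (key (i : 'I_14) == key (j : 'I_14)).
Proof. by rewrite /edge /= /nat_edge (eq_sym (key (j : 'I_14))) orbb. Qed.

Lemma edge_cluster_class key m (i j : cluster key) :
  edge i j -> cluster_class m i = cluster_class m j.
Proof. by rewrite cluster_edgeE /cluster_class => /andP[_ /eqP ->]. Qed.

Definition cluster_strips key m (r : cluster key -> rect) d B (c : 'I_m.+1) : nat :=
  #|class_strips (@cluster_class key m) r d B c|.

Lemma cluster_strips_sum key m (r : cluster key -> rect) d B :
  strip_representation r ->
  (\sum_(c < m.+1) cluster_strips r d B c <= extent d B)%N.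
Proof.
by move=> rep; apply: class_strips_sum => // i j; apply: edge_cluster_class.
Qed.

Lemma cluster_strips_sum2 key m (r : cluster key -> rect) B :
  strip_representation r ->
  (\sum_(c < m.+1) (cluster_strips r true B c + cluster_strips r false B c) <=
   extent true B + extent false B)%N.
Proof. by move=> rep; rewrite big_split leq_add ?cluster_strips_sum. Qed.

Lemma cluster_strips_gt0 key m (r : cluster key -> rect) d B (i : cluster key) :
  encloses B r -> (0 < cluster_strips r d B (cluster_class m i))%N.
Proof.
move=> en; have [u uS _] := class_strips_lo (@cluster_class key m) d i en.
by apply/card_gt0P; exists u.
Qed.

Lemma cluster_strips_pair key m (r : cluster key -> rect) B (i j : cluster key) :
  strip_representation r -> encloses B r -> edge i j ->
  (3 <= cluster_strips r true B (cluster_class m i) +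
        cluster_strips r false B (cluster_class m i))%N.
Proof.
move=> rep en ij.
have two : (1 < #|[set x : cluster key | cluster_class m x == cluster_class m i]|)%N.
  apply/card_gt1P; exists i, j.
  by rewrite !inE eqxx -(edge_cluster_class m ij) eqxx (edge_neq ij).
have := leq_trans two (card_class_le _ _ rep.1 en).
rewrite -!/(cluster_strips _ _ _ _).
case: cluster_strips => [|[|a]] //; case: cluster_strips => [|[|b]] //; lia.
Qed.

Lemma cluster_strips_triangle key m (r : cluster key -> rect) d B
    (i j k : cluster key) :
  strip_representation r -> encloses B r -> edge i j -> edge j k -> edge i k ->
  (2 <= cluster_strips r d B (cluster_class m i))%N.
Proof.
by move=> rep en; apply: triangle_class_strips => // x y; apply: edge_cluster_class.
Qed.

Lemma cluster_edge_inord (key : nat -> nat) (i j : nat) :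
  (i < 14)%N -> (j < 14)%N -> i != j -> key i = key j ->
  edge (inord i : cluster key) (inord j : cluster key).
Proof.
move=> i14 j14 ij kij.
by rewrite cluster_edgeE -(inj_eq val_inj) /= !inordK // ij kij eqxx.
Qed.

Lemma cluster_class_inord (key : nat -> nat) m (i : nat) (c : 'I_m.+1) :
  (i < 14)%N -> key i = c -> cluster_class m (inord i : cluster key) = c.
Proof. by move=> i14 kc; rewrite /cluster_class inordK // kc inord_val. Qed.

Definition matching := cluster matching_key.
Definition near_matching := cluster near_matching_key.
Definition triangles := cluster triangles_key.

Lemma matching_box (r : matching -> rect) B :
  strip_representation r -> encloses B r ->
  (21 <= extent true B + extent false B)%N.
Proof.
move=> rep en; apply: leq_trans (cluster_strips_sum2 6 B rep).
apply: (@leq_trans (\sum_(c < 7) 3)%N); first by rewrite sum_nat_const card_ord.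
apply: leq_sum => c _; have c7 := ltn_ord c.
have <- : cluster_class 6 (inord (2 * c) : matching) = c.
  by apply: cluster_class_inord; rewrite /matching_key; lia.
apply: (@cluster_strips_pair _ _ _ _ _ (inord (2 * c).+1)) => //.
by apply: cluster_edge_inord; rewrite /matching_key; lia.
Qed.

Lemma near_matching_box (r : near_matching -> rect) B :
  strip_representation r -> encloses B r ->
  (22 <= extent true B + extent false B)%N /\ forall d, (8 <= extent d B)%N.
Proof.
move=> rep en.
(* This is the first vertex of class c. *)
have classE (c : 'I_8) :
    cluster_class 7 (inord (minn (2 * c) (c + 6)) : near_matching) = c.
  have c8 := ltn_ord c.
  by apply: cluster_class_inord; rewrite /near_matching_key; lia.
split=> [|d].
  apply: leq_trans (cluster_strips_sum2 7 B rep).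
  apply: (@leq_trans (\sum_(c < 8) if (c < 6)%N then 3 else 2)%N);
  first by rewrite !big_ord_recr big_ord0.
  apply: leq_sum => c _; case: ifP => c6; rewrite -(classE c); last first.
    by rewrite -[2%N]/(1 + 1)%N leq_add ?cluster_strips_gt0.
  apply: (@cluster_strips_pair _ _ _ _ _ (inord (2 * c).+1)) => //.
  by apply: cluster_edge_inord; rewrite /near_matching_key; lia.
apply: leq_trans (cluster_strips_sum 7 d B rep).
apply: (@leq_trans (\sum_(c < 8) 1)%N); first by rewrite sum_nat_const card_ord.
by apply: leq_sum => c _; rewrite -(classE c) cluster_strips_gt0.
Qed.

Lemma triangles_box (r : triangles -> rect) B d :
  strip_representation r -> encloses B r -> (10 <= extent d B)%N.
Proof.
move=> rep en; apply: leq_trans (cluster_strips_sum 5 d B rep).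
apply: (@leq_trans (\sum_(c < 6) if (c < 4)%N then 2 else 1)%N);
  first by rewrite !big_ord_recr big_ord0.
apply: leq_sum => c _; have c6 := ltn_ord c.
have classE i : (i < 14)%N -> triangles_key i = c ->
    cluster_class 5 (inord i : triangles) = c by exact: cluster_class_inord.
case: ifP => c4.
  rewrite -(classE (3 * c)%N); [|lia|by rewrite /triangles_key; lia].
  by apply: (@cluster_strips_triangle _ _ _ _ _ _ (inord (3 * c).+1)
    (inord (3 * c).+2)) => //; apply: cluster_edge_inord;
    rewrite /triangles_key; lia.
rewrite -(classE (c + 8)%N); [|lia|by rewrite /triangles_key; lia].
exact: cluster_strips_gt0.
Qed.

End Proofs.

Theorem mainTheorem1 (R : realType) (p q : parameter) (hpq : p <> q) :
  exists G1 G2 : graph,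
    [/\ RVG R G1, RVG R G2, #|G1| = #|G2|,
        (graph_param R p G1 < graph_param R p G2)%N &
        (graph_param R q G2 < graph_param R q G1)%N].
Proof.
have card14 e : #|nat_graph 14 e| = 14 by rewrite card_ord.
have gt0 e : (0 < #|nat_graph 14 e|)%N by rewrite card14.
have rvD := nat_graph_RVG R double_fan_represents.
have rvM := nat_graph_RVG R matching_represents.
have rvN := nat_graph_RVG R near_matching_represents.
have rvT := nat_graph_RVG R triangles_represents.
pose T := triangles.
have T_le s : (graph_param R s T <= size_param s 10 10)%N.
  exact: nat_graph_param_le triangles_represents.
have T_ge s : (size_param s 10 10 <= graph_param R s T)%N.
  apply: (graph_param_ge (gt0 _) rvT) => r B rep en.
  by apply: size_param_le; apply: triangles_box rep en.
pose opposed s t := exists G1 G2 : graph,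
  [/\ RVG R G1, RVG R G2, #|G1| = #|G2|,
      (graph_param R s G1 < graph_param R s G2)%N &
      (graph_param R t G2 < graph_param R t G1)%N].
have opposedC s t : opposed s t -> opposed t s.
  by move=> [G1 [G2 [? ? ? ? ?]]]; exists G2, G1.
(* Here W x H is the size of one representation, and m a lower bound for all. *)
have vs_T e s t W H m : RVG R (nat_graph 14 e) ->
    (graph_param R s (nat_graph 14 e) <= size_param s W H)%N ->
    (size_param s W H < size_param s 10 10)%N ->
    (forall (r : nat_graph 14 e -> Defs.int_rect) B,
       strip_representation r -> encloses B r ->
       (m <= size_param t (extent true B) (extent false B))%N) ->
    (size_param t 10 10 < m)%N -> opposed s t.
  move=> rv le lt ge gt; exists (nat_graph 14 e), T; split.
  - exact: rv.
  - exact: rvT.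
  - exact: etrans (card14 _) (esym (card14 _)).
  - exact: leq_ltn_trans le (leq_trans lt (T_ge s)).
  - exact: leq_ltn_trans (T_le t) (leq_trans gt (graph_param_ge (gt0 e) rv ge)).
have fan s : (size_param s 12 3 < size_param s 10 10)%N -> opposed s Width.
  move=> lt; apply: (vs_T _ _ _ 12 3 12 rvD) => //.
    exact: nat_graph_param_le double_fan_represents.
  exact: double_fan_box.
have match7 s : (size_param s 14 7 < size_param s 10 10)%N -> opposed s Perimeter.
  move=> lt; apply: (vs_T _ _ _ 14 7 42 rvM) => //.
    exact: nat_graph_param_le matching_represents.
  by move=> r B rep en; rewrite /= -[42]/(2 * 21)%N leq_mul // (matching_box rep en).
have height_area : opposed Height Area.
  apply: (vs_T _ _ _ 14 8 112 rvN) => //.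
    exact: nat_graph_param_le near_matching_represents.
  move=> r B rep en /=; have [sum8 ge8] := near_matching_box rep en.
  have := ge8 true; have := ge8 false; nia.
by case: p q hpq => [] [] // _; do ?[exact: fan|exact: match7|exact: height_area];
  apply: opposedC; do ?[exact: fan|exact: match7|exact: height_area].
Qed.
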